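(* Let $r,p,m\ge 1$ be integers, and let $\mathbf{G}$ be the $p\times m$ matrix-valued rational function $$\mathbf{G}(s)=\frac{\sum_{j=1}^{r}\frac{\Phi_j}{s-\lambda_j}}{1+\sum_{j=1}^{r}\frac{\varphi_j}{s-\lambda_j}},\qquad \Phi_j\in\mathbb{C}^{p\times m},\quad \varphi_j,\lambda_j\in\mathbb{C},\quad |\varphi_j|+\|\Phi_j\|_F>0\quad (j=1,\dots,r),$$ where $\lambda_1,\dots,\lambda_r$ are distinct and closed under complex conjugation, and the $\varphi_j$ and $\Phi_j$ have the compatible conjugation symmetry: $\varphi_j$ and $\Phi_j$ are real if $\lambda_j$ is real, and $\varphi_i=\overline{\varphi_j}$, $\Phi_i=\overline{\Phi_j}$ if $\lambda_i=\overline{\lambda_j}$. Let $$\mathcal{J}_0=\{j:\varphi_j=0\},\qquad \mathcal{J}_1=\{j:\varphi_j\neq 0\}.$$ The points $\lambda_j$, $j\in\mathcal{J}_0$, are among the poles of $\mathbf{G}$. Let the remaining poles of $\mathbf{G}$ be indexed as $\widehat{\lambda}_j$, $j\in\mathcal{J}_1$ (pairwise distinct, one for each index in $\mathcal{J}_1$). Assume that all poles of $\mathbf{G}$ are simple. Then $$\mathbf{G}(s)=\sum_{j\in\mathcal{J}_1}\frac{\widehat{R}_j}{s-\widehat{\lambda}_j}+\sum_{j\in\mathcal{J}_0}\frac{R_j}{s-\lambda_j},$$ where the residues are given by $$R_j=\frac{\Phi_j}{1+\sum_{i\in\mathcal{J}_1}\varphi_i/(\lambda_j-\lambda_i)},\quad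 j\in\mathcal{J}_0,$$ $$\widehat{R}_j=\frac{\prod_{i\in\mathcal{J}_1}(\widehat{\lambda}_j-\lambda_i)}{\prod_{i\in\mathcal{J}_1,\,i\neq j}(\widehat{\lambda}_j-\widehat{\lambda}_i)}\sum_{i=1}^{r}\frac{\Phi_i}{\widehat{\lambda}_j-\lambda_i},\quad j\in\mathcal{J}_1.$$
   Context: $\|\cdot\|_F$ denotes the Frobenius norm and the bar denotes (entrywise) complex conjugation. A set of complex numbers is closed under conjugation if its non-real members appear in complex conjugate pairs. $\mathbf{G}$ is regarded as a matrix of rational functions, so removable singularities (such as those at $\lambda_j$ with $\varphi_j\neq 0$) are not poles; a pole of $\mathbf{G}$ is a pole of at least one entry, and it is simple if every entry has a pole of order at most one there. Empty sums equal $0$ and empty products equal $1$. *)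

(* Defs.v *)
From HB Require Import structures.
From mathcomp Require Import all_boot all_order all_algebra.
From mathcomp Require Import reals complex.

Set Implicit Arguments.
Unset Strict Implicit.
Unset Printing Implicit Defensive.

Import Order.TTheory GRing.Theory Num.Theory.
Local Open Scope ring_scope.

Notation ratfun F := {fraction {poly F}}.

Section RationalFunctions.
Variable F : numClosedFieldType.

Local Notation "a %:F" := (tofrac a) : ring_scope.

Definition rcst (c : F) : ratfun F := (c%:P)%:F.

Definition sub_pt (z : F) : ratfun F := ('X - z%:P)%:F.

(* f * (s - z)^n has no pole at z, i.e. it is a fraction whose denominator
   does not vanish at z (an arbitrary, not necessarily reduced, fraction
   representing f may be used).  For n = 0 this says that f has no pole at z;
   removable singularities do not count as poles. *)
Definition pole_order_le (f : ratfun F) (z : F) (n : nat) : Prop :=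
  exists a b : {poly F}, b.[z] != 0 /\ f * sub_pt z ^+ n = a%:F / b%:F.

Definition is_pole p m (G : 'M[ratfun F]_(p, m)) (z : F) : Prop :=
  exists i k, ~ pole_order_le (G i k) z 0.

Definition all_poles_simple p m (G : 'M[ratfun F]_(p, m)) : Prop :=
  forall z, is_pole G z -> forall i k, pole_order_le (G i k) z 1.

End RationalFunctions.

Definition frobenius (C : numClosedFieldType) p m (A : 'M[C]_(p, m)) : C :=
  sqrtC (\sum_i \sum_k `|A i k| ^+ 2).

Section BarycentricForm.
Variables (C : numClosedFieldType) (r p m : nat).
Implicit Types (Phi : 'I_r -> 'M[C]_(p, m)) (phi lambda : 'I_r -> C).

Definition conj_closed lambda : Prop :=
  forall j, lambda j \isn't Num.real -> exists i, lambda i = (lambda j)^*.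

Definition conj_compatible Phi phi lambda : Prop :=
  (forall j, lambda j \is Num.real ->
     phi j \is Num.real /\ Phi j \is a mxOver Num.real) /\
  (forall i j, lambda i = (lambda j)^* ->
     phi i = (phi j)^* /\ Phi i = map_mx Num.conj (Phi j)).

Definition J0 phi : {set 'I_r} := [set j | phi j == 0].
Definition J1 phi : {set 'I_r} := [set j | phi j != 0].

Definition barycentric Phi phi lambda : 'M[ratfun C]_(p, m) :=
  (1 + \sum_j rcst (phi j) / sub_pt (lambda j))^-1
  *: \sum_j (sub_pt (lambda j))^-1 *: map_mx (@rcst C) (Phi j).

(* lambdahat is only meaningful on J1: there it enumerates, without
   repetition, exactly the poles other than the lambda j, j in J0. *)
Definition remaining_poles Phi phi lambda (lambdahat : 'I_r -> C) : Prop :=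
  {in J1 phi &, injective lambdahat} /\
  (forall z, (exists2 j, j \in J1 phi & lambdahat j = z) <->
     is_pole (barycentric Phi phi lambda) z /\
     (forall j, j \in J0 phi -> lambda j <> z)).

Definition residue0 Phi phi lambda (j : 'I_r) : 'M[C]_(p, m) :=
  (1 + \sum_(i in J1 phi) phi i / (lambda j - lambda i))^-1 *: Phi j.

Definition residue1 Phi phi lambda (lambdahat : 'I_r -> C) (j : 'I_r) :
    'M[C]_(p, m) :=
  ((\prod_(i in J1 phi) (lambdahat j - lambda i)) /
   (\prod_(i in J1 phi | i != j) (lambdahat j - lambdahat i)))
  *: \sum_i (lambdahat j - lambda i)^-1 *: Phi i.

End BarycentricForm.

(* Main.v *)
Require Import Defs.
From HB Require Import structures.
From mathcomp Require Import all_boot all_order all_algebra.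
From mathcomp Require Import reals complex ring.

(** Put everything over the common denominator [\prod_j ('X - lambda j)].  The
    entry [(i, k)] of the matrix is then [N i k / D], where
    [N i k = \sum_j Phi j i k * \prod_(i' != j) ('X - lambda i')] has degree
    less than [r] and
    [D = \prod_j ('X - lambda j) + \sum_j phi j * \prod_(i != j) ('X - lambda i)]
    is monic of degree [r].

    At a node, [D] takes the value [phi j] times a nonzero number and [N i k]
    takes the value [Phi j i k] times the same number.  If [phi j = 0], then
    [D] vanishes at [lambda j] while some [N i k] does not, so [lambda j] is a
    pole ([J0_is_pole]).  Every pole is a root of [D]; hence the [lambda j] with
    [phi j = 0] and the remaining poles, one for each other index, form [r]
    distinct roots [mu j] of [D], and so [D = \prod_j ('X - mu j)]
    ([denpoly_split]).  Lagrange interpolation of [N i k] at the [mu j]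
    ([partial_fraction]) gives the expansion of the matrix, with residue
    [N i k] over [\prod_(i' != j) ('X - mu i')], evaluated at [mu j].  The
    lemmas [residue0E] and [residue1E] bring these residues to the stated
    form.  In particular the simplicity of the poles is automatic once there
    are as many remaining poles as nonzero [phi j]. *)

Set Implicit Arguments.
Unset Strict Implicit.
Unset Printing Implicit Defensive.

Import Order.TTheory GRing.Theory Num.Theory.
Local Open Scope ring_scope.

(** * Nodal polynomials and Lagrange interpolation *)

Section Nodes.
Variables (F : fieldType) (r : nat).
Implicit Types (mu c : 'I_r -> F) (N : {poly F}).

(** The monic polynomial whose roots are the nodes [mu j]. *)
Definition nodal mu : {poly F} := \prod_j ('X - (mu j)%:P).

(** The nodal polynomial with the factor of index [j] left out. *)
Definition conodal mu (j : 'I_r) : {poly F} :=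
  \prod_(i | i != j) ('X - (mu i)%:P).

Lemma nodalE mu j : nodal mu = ('X - (mu j)%:P) * conodal mu j.
Proof. by rewrite /nodal (bigD1 j). Qed.

Lemma nodal_codom mu : nodal mu = \prod_(z <- codom mu) ('X - z%:P).
Proof. by rewrite big_image. Qed.

Lemma size_nodal mu : size (nodal mu) = r.+1.
Proof. by rewrite nodal_codom size_prod_XsubC size_codom card_ord. Qed.

Lemma size_conodal mu j : size (conodal mu j) = r.
Proof.
have := size_nodal mu; rewrite (nodalE mu j) size_Mmonic ?polyXsubC_eq0 //.
  by rewrite size_XsubC /= => -[].
exact: monic_prod_XsubC.
Qed.

Lemma horner_nodal mu x : (nodal mu).[x] = \prod_j (x - mu j).
Proof. by rewrite horner_prod; apply: eq_bigr => i _; rewrite hornerXsubC. Qed.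

Lemma horner_conodal mu j x :
  (conodal mu j).[x] = \prod_(i | i != j) (x - mu i).
Proof. by rewrite horner_prod; apply: eq_bigr => i _; rewrite hornerXsubC. Qed.

Lemma conodal_eq0 mu i j : i != j -> (conodal mu i).[mu j] = 0.
Proof.
by move=> ij; rewrite horner_conodal (bigD1 j) 1?eq_sym //= subrr mul0r.
Qed.

Lemma conodal_neq0 mu j : injective mu -> (conodal mu j).[mu j] != 0.
Proof.
move=> muI; rewrite horner_conodal; apply/prodf_neq0 => i ij.
by rewrite subr_eq0 (inj_eq muI) eq_sym.
Qed.

(** The numerator of [\sum_j c j / ('X - mu j)] over the denominator
    [nodal mu]. *)
Definition cosum mu c : {poly F} := \sum_j c j *: conodal mu j.

Lemma size_cosum mu c : (size (cosum mu c) <= r)%N.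
Proof.
apply: (leq_trans (size_sum _ _ _)); apply/bigmax_leqP => j _.
by rewrite (leq_trans (size_scale_leq _ _)) // size_conodal.
Qed.

Lemma horner_cosum mu c j : (cosum mu c).[mu j] = c j * (conodal mu j).[mu j].
Proof.
rewrite horner_sum (bigD1 j) //= hornerZ big1 ?addr0 // => i ij.
by rewrite hornerZ conodal_eq0 ?mulr0.
Qed.

Lemma horner_cosum_off mu c x : (forall i, x != mu i) ->
  (cosum mu c).[x] = (nodal mu).[x] * \sum_i (x - mu i)^-1 * c i.
Proof.
move=> xmu; rewrite horner_sum mulr_sumr; apply: eq_bigr => i _.
rewrite hornerZ (nodalE mu i) hornerM hornerXsubC; field.
by rewrite subr_eq0.
Qed.

Lemma lagrange_interpolation mu N : injective mu -> (size N <= r)%N ->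
  N = cosum mu (fun j => N.[mu j] / (conodal mu j).[mu j]).
Proof.
move=> muI sN; set S := cosum _ _.
apply/eqP; rewrite -subr_eq0; apply/eqP.
apply: (@roots_geq_poly_eq0 _ _ (codom mu)).
- apply/allP => _ /codomP[j ->]; rewrite rootE !hornerE horner_cosum.
  by rewrite divfK ?subrr // conodal_neq0.
- by apply/injectiveP.
- rewrite size_codom card_ord (leq_trans (size_polyD _ _)) //.
  by rewrite geq_max sN size_polyN size_cosum.
Qed.

(** * The common denominator *)

(** [1 + \sum_j c j / ('X - mu j)] multiplied by [nodal mu]. *)
Definition denpoly mu c : {poly F} := nodal mu + cosum mu c.

Lemma size_denpoly mu c : size (denpoly mu c) = r.+1.
Proof. by rewrite size_polyDl size_nodal // ltnS size_cosum. Qed.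

Lemma denpoly_neq0 mu c : denpoly mu c != 0.
Proof. by rewrite -size_poly_eq0 size_denpoly. Qed.

Lemma lead_coef_denpoly mu c : lead_coef (denpoly mu c) = 1.
Proof.
rewrite lead_coefDl ?size_nodal ?ltnS ?size_cosum //.
exact/monicP/monic_prod_XsubC.
Qed.

Lemma horner_denpoly mu c j :
  (denpoly mu c).[mu j] = c j * (conodal mu j).[mu j].
Proof.
by rewrite hornerD (nodalE mu j) hornerM hornerXsubC subrr mul0r add0r
  horner_cosum.
Qed.

Lemma denpoly_split mu c nu : injective nu ->
  (forall j, root (denpoly mu c) (nu j)) -> denpoly mu c = nodal nu.
Proof.
move=> nuI rt.
rewrite (@all_roots_prod_XsubC _ (denpoly mu c) (codom nu)).
- by rewrite lead_coef_denpoly scale1r nodal_codom.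
- by rewrite size_denpoly size_codom card_ord.
- by apply/allP => _ /codomP[j ->].
- by rewrite uniq_rootsE; apply/injectiveP.
Qed.

(** The derivative of the common denominator at a node [mu j] of weight zero,
    computed from its two factorisations by cancelling ['X - mu j]. *)
Lemma horner_conodal_split mu c nu j : injective mu ->
    denpoly mu c = nodal nu -> nu j = mu j -> c j = 0 ->
  (conodal nu j).[mu j] =
    (conodal mu j).[mu j] * (1 + \sum_(i | c i != 0) c i / (mu j - mu i)).
Proof.
move=> muI; rewrite (nodalE nu j) => E nuj cj.
(* For [i != j], [conodal mu i = ('X - mu j) * K i]. *)
pose K i : {poly F} := \prod_(k | (k != i) && (k != j)) ('X - (mu k)%:P).
have cofE : conodal nu j = conodal mu j + \sum_(i | c i != 0) c i *: K i.
  apply: (@mulfI _ ('X - (mu j)%:P)); first by rewrite polyXsubC_eq0.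
  rewrite -[in LHS]nuj -E /denpoly (nodalE mu j) mulrDr; congr (_ + _).
  rewrite mulr_sumr /cosum [LHS](bigID (fun i => c i != 0)) /= [X in _ + X]big1.
    rewrite addr0; apply: eq_bigr => i ci; rewrite -scalerAr; congr (_ *: _).
    rewrite /conodal (bigD1 j) //; by apply: contraNneq ci => <-; rewrite cj.
  by move=> i /negPn/eqP ->; rewrite scale0r.
rewrite cofE hornerD mulrDr mulr1; congr (_ + _).
rewrite horner_sum mulr_sumr; apply: eq_bigr => i ci; rewrite hornerZ.
have ij : i != j by apply: contraNneq ci => ->; rewrite cj.
rewrite [in RHS]/conodal (bigD1 i) //= hornerM hornerXsubC.
rewrite (eq_bigl (fun k => (k != i) && (k != j))); last by move=> k; rewrite andbC.
rewrite -/(K i); field.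
by rewrite subr_eq0 (inj_eq muI) eq_sym.
Qed.

End Nodes.

(** * Rational functions and their poles *)

Section RationalEntries.
Variables (C : numClosedFieldType) (r : nat).
Implicit Types (mu c : 'I_r -> C) (N D : {poly C}) (z : C).

Local Notation "a %:F" := (tofrac a) : ring_scope.

Lemma sub_pt_neq0 z : sub_pt z != 0.
Proof. by rewrite tofrac_eq0 polyXsubC_eq0. Qed.

Lemma nodal_neq0 mu : (nodal mu)%:F != 0.
Proof. by rewrite tofrac_eq0 -size_poly_eq0 size_nodal. Qed.

Lemma sum_partial_fractions mu c :
  \sum_j rcst (c j) / sub_pt (mu j) = (cosum mu c)%:F / (nodal mu)%:F.
Proof.
rewrite /cosum rmorph_sum mulr_suml /=; apply: eq_bigr => j _.
have := nodal_neq0 mu; rewrite (nodalE mu j) -mul_polyC !tofracM mulf_eq0.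
by case/norP=> _ k0; rewrite -mulf_div divff ?mulr1.
Qed.

Lemma partial_fraction mu N : injective mu -> (size N <= r)%N ->
  N%:F / (nodal mu)%:F =
    \sum_j (sub_pt (mu j))^-1 * rcst (N.[mu j] / (conodal mu j).[mu j]).
Proof.
move=> muI sN; rewrite {1}(lagrange_interpolation muI sN).
by rewrite -sum_partial_fractions; apply: eq_bigr => j _; rewrite mulrC.
Qed.

Lemma no_pole_off_denominator N D z :
  D.[z] != 0 -> pole_order_le (N%:F / D%:F) z 0.
Proof. by move=> Dz; exists N, D; rewrite expr0 mulr1. Qed.

Lemma pole_at_denominator_root N D z : D != 0 -> D.[z] = 0 -> N.[z] != 0 ->
  ~ pole_order_le (N%:F / D%:F) z 0.
Proof.
move=> D0 Dz Nz [a [b [bz]]]; rewrite expr0 mulr1 => /eqP.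
have b0 : b != 0 by apply: contraNneq bz => ->; rewrite horner0.
rewrite eqr_div ?tofrac_eq0 // -!tofracM tofrac_eq => /eqP/(congr1 (horner^~ z)).
by rewrite /= !hornerM Dz mulr0 => /eqP; apply/negP; rewrite mulf_neq0.
Qed.

End RationalEntries.

(** * The barycentric form and its residues *)

Section Barycentric.
Variables (C : numClosedFieldType) (r p m : nat).
Variables (Phi : 'I_r -> 'M[C]_(p, m)) (phi lambda : 'I_r -> C).
Hypothesis lambdaI : injective lambda.

Local Notation "a %:F" := (tofrac a) : ring_scope.
Local Notation G := (barycentric Phi phi lambda).

(** The numerator of the entry [(i, k)] over the denominator
    [denpoly lambda phi]. *)
Definition numpoly (i : 'I_p) (k : 'I_m) : {poly C} :=
  cosum lambda (fun j => Phi j i k).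

Lemma barycentricE i k : G i k = (numpoly i k)%:F / (denpoly lambda phi)%:F.
Proof.
rewrite mxE summxE sum_partial_fractions.
under eq_bigr do rewrite !mxE mulrC.
rewrite sum_partial_fractions -/(numpoly i k).
have L0 := nodal_neq0 lambda.
have -> : 1 + (cosum lambda phi)%:F / (nodal lambda)%:F =
    (denpoly lambda phi)%:F / (nodal lambda)%:F.
  by rewrite tofracD mulrDl mulfV.
by rewrite invf_div mulrC mulrA divfK.
Qed.

Lemma frobenius_eq0 (A : 'M[C]_(p, m)) :
  (forall i k, A i k = 0) -> frobenius A = 0.
Proof.
move=> A0; rewrite /frobenius big1 ?sqrtC0 // => i _; rewrite big1 // => k _.
by rewrite A0 normr0 expr0n.
Qed.

Lemma J0_is_pole j : 0 < `|phi j| + frobenius (Phi j) -> j \in J0 phi ->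
  is_pole G (lambda j).
Proof.
move=> nz; rewrite inE => /eqP pj.
have [/existsP[i /existsP[k nzik]]|A0] :=
  boolP [exists i, exists k, Phi j i k != 0]; last first.
  move: nz; rewrite pj normr0 add0r frobenius_eq0 ?ltxx // => i k.
  apply/eqP; apply: contraNT A0 => Aik.
  by apply/existsP; exists i; apply/existsP; exists k.
exists i, k; rewrite barycentricE; apply: pole_at_denominator_root.
- exact: denpoly_neq0.
- by rewrite horner_denpoly pj mul0r.
- by rewrite horner_cosum mulf_neq0 // conodal_neq0.
Qed.

Lemma pole_is_root z : is_pole G z -> root (denpoly lambda phi) z.
Proof.
case=> i [k nP]; apply/rootP/eqP; apply/negPn/negP => Dz.
by apply: nP; rewrite barycentricE; apply: no_pole_off_denominator.
Qed.

Variable lambdahat : 'I_r -> C.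
Hypothesis lambdahatP : remaining_poles Phi phi lambda lambdahat.

(** All the poles, indexed by ['I_r]: the node itself where the weight
    vanishes, the remaining pole elsewhere. *)
Definition poles (j : 'I_r) : C :=
  if j \in J1 phi then lambdahat j else lambda j.

Lemma J0E j : (j \in J0 phi) = (j \notin J1 phi).
Proof. by rewrite !inE negbK. Qed.

Lemma lambdahat_is_pole j : j \in J1 phi -> is_pole G (lambdahat j).
Proof.
by move=> jJ; have [_ /(_ (lambdahat j))[+ _]] := lambdahatP; case; first exists j.
Qed.

Lemma lambdahat_neq_J0 j i : j \in J1 phi -> i \notin J1 phi ->
  lambdahat j != lambda i.
Proof.
move=> jJ iJ; have [_ /(_ (lambdahat j))[+ _]] := lambdahatP.
case; first by exists j.
by move=> _ /(_ i); rewrite J0E eq_sym => /(_ iJ)/eqP.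
Qed.

Lemma root_poles j : root (denpoly lambda phi) (poles j).
Proof.
rewrite /poles; case: ifPn => jJ; first exact/pole_is_root/lambdahat_is_pole.
by rewrite -J0E inE in jJ; rewrite rootE horner_denpoly (eqP jJ) mul0r.
Qed.

Lemma poles_inj : injective poles.
Proof.
move=> i j; rewrite /poles.
case: ifPn => iJ; case: ifPn => jJ; last exact: lambdaI.
- by apply: lambdahatP.1.
- by move/eqP; rewrite (negPf (lambdahat_neq_J0 iJ jJ)).
- by move/esym/eqP; rewrite (negPf (lambdahat_neq_J0 jJ iJ)).
Qed.

Lemma denpoly_poles : denpoly lambda phi = nodal poles.
Proof. exact: denpoly_split poles_inj root_poles. Qed.

Lemma lambdahat_neq j i : j \in J1 phi -> lambdahat j != lambda i.
Proof.
move=> jJ; have [iJ|] := boolP (i \in J1 phi); last exact: lambdahat_neq_J0.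
apply/eqP => E; have /rootP := pole_is_root (lambdahat_is_pole jJ).
rewrite E horner_denpoly => /eqP; apply/negP.
by rewrite mulf_neq0 ?conodal_neq0 //; rewrite inE in iJ.
Qed.

Lemma residue0E j i k : j \in J0 phi ->
  (numpoly i k).[poles j] / (conodal poles j).[poles j] =
    residue0 Phi phi lambda j i k.
Proof.
move=> jJ0; have jJ : j \notin J1 phi by rewrite -J0E.
have pj : poles j = lambda j by rewrite /poles (negPf jJ).
have cj : phi j = 0 by move: jJ0; rewrite inE => /eqP.
rewrite {2}pj (horner_conodal_split lambdaI denpoly_poles pj cj) pj horner_cosum.
rewrite mxE invfM mulrA mulfK ?conodal_neq0 // mulrC; congr (_^-1 * _).
by congr (1 + _); apply: eq_bigl => l; rewrite inE.
Qed.

(** The factors of index in [J0 phi] are common to [nodal lambda] and to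
    [conodal poles j]; cancelling them leaves the products over [J1 phi]. *)
Lemma residue1E j i k : j \in J1 phi ->
  (numpoly i k).[poles j] / (conodal poles j).[poles j] =
    residue1 Phi phi lambda lambdahat j i k.
Proof.
move=> jJ; have pj : poles j = lambdahat j by rewrite /poles jJ.
rewrite pj horner_cosum_off; last by move=> l; apply: lambdahat_neq.
rewrite horner_nodal horner_conodal mxE summxE [RHS]mulrC.
under [X in _ = X * _]eq_bigr do rewrite mxE.
rewrite [_ * \sum_(l < r) _]mulrC -mulrA; congr (_ * _).
rewrite (bigID (mem (J1 phi))) [X in _ / X](bigID (mem (J1 phi))) /=.
have -> : \prod_(l | (l != j) && (l \notin J1 phi)) (lambdahat j - poles l) =
    \prod_(l | l \notin J1 phi) (lambdahat j - lambda l).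
  apply: eq_big => l; last by case/andP=> _ lJ; rewrite /poles (negPf lJ).
  by have [->|//] := eqVneq l j; rewrite jJ.
rewrite -mulf_div divff ?mulr1; last first.
  by apply/prodf_neq0 => l _; rewrite subr_eq0 lambdahat_neq.
congr (_ / _); apply: eq_big => l; first by rewrite andbC.
by case/andP=> _ lJ; rewrite /poles lJ.
Qed.

Lemma barycentric_expansion :
  G = \sum_(j in J1 phi) (sub_pt (lambdahat j))^-1 *:
        map_mx (@rcst _) (residue1 Phi phi lambda lambdahat j)
    + \sum_(j in J0 phi) (sub_pt (lambda j))^-1 *:
        map_mx (@rcst _) (residue0 Phi phi lambda j).
Proof.
apply/matrixP => i k; rewrite barycentricE denpoly_poles.
rewrite (partial_fraction poles_inj) ?size_cosum //.
rewrite (bigID (mem (J1 phi))) mxE !summxE /=; congr (_ + _).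
  by apply: eq_bigr => j jJ; rewrite residue1E // !mxE /poles jJ.
apply: eq_big => [j|j jJ]; first by rewrite J0E.
by rewrite residue0E ?J0E // !mxE /poles (negPf jJ).
Qed.

End Barycentric.

Theorem proposition2p1 (R : realType) (r p m : nat)
    (r_ge1 : (1 <= r)%N) (p_ge1 : (1 <= p)%N) (m_ge1 : (1 <= m)%N)
    (Phi : 'I_r -> 'M[R[i]]_(p, m)) (phi lambda : 'I_r -> R[i])
    (nontrivial : forall j, 0 < `|phi j| + frobenius (Phi j))
    (lambda_distinct : injective lambda)
    (lambda_conj : conj_closed lambda)
    (compatible : conj_compatible Phi phi lambda) :
  let G := barycentric Phi phi lambda in
  (forall j, j \in J0 phi -> is_pole G (lambda j)) /\
  (forall lambdahat : 'I_r -> R[i],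
     remaining_poles Phi phi lambda lambdahat ->
     all_poles_simple G ->
     G = \sum_(j in J1 phi) (sub_pt (lambdahat j))^-1 *:
           map_mx (@rcst _) (residue1 Phi phi lambda lambdahat j)
       + \sum_(j in J0 phi) (sub_pt (lambda j))^-1 *:
           map_mx (@rcst _) (residue0 Phi phi lambda j)).
Proof.
move=> G; split=> [j|lambdahat polesP _].
  exact: J0_is_pole.
exact: barycentric_expansion.
Qed.
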